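(* If $h>0$ and $\beta>0$, then the $Q$-process is always positive recurrent.
   Context: Let $\mathbf E=\{0,1,2,\dots\}$ and let $c\ge 1$ be an integer (the number of servers). Let $(b_j)_{j\ge0}$ be reals with $b_j\ge 0$ for $j\ne 1$, $0<-b_1=\sum_{j\ne1}b_j<\infty$, $b_0>0$ and $\sum_{j\ge2}b_j>0$. Let $\beta\ge0$ and $h_j\ge0$ ($j\ge1$) with $0\le h:=\sum_{j\ge1}h_j<\infty$. The $M^X/M/c$ queue with resurrection and catastrophes (the $Q$-process) is the continuous-time Markov chain on $\mathbf E$ with conservative bounded $q$-matrix $Q=Q^*+Q_s+Q_d$, where: $Q^*$ has entries $q^*_{i,i-1}=\min(i,c)b_0$, $q^*_{ii}=b_1-[\min(i,c)-1]b_0$, $q^*_{ij}=b_{j-i+1}$ ($j\ge i+1$) for $i\ge1$, and $0$ otherwise; $Q_s$ has entries $q^{(s)}_{00}=-h$, $q^{(s)}_{0j}=h_j$ ($j\ge1$), and $0$ otherwise; $Q_d$ has entries $q^{(d)}_{i0}=\beta$, $q^{(d)}_{ii}=-\beta$ for $i\ge1$, and $0$ otherwise. *)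

(* Defs.v *)
From HB Require Import structures.
From mathcomp Require Import all_boot all_order all_algebra.
From mathcomp Require Import all_classical all_reals all_analysis.

Set Implicit Arguments.
Unset Strict Implicit.
Unset Printing Implicit Defensive.

Import Order.TTheory GRing.Theory Num.Theory.
Import numFieldNormedType.Exports.

Local Open Scope classical_set_scope.
Local Open Scope ring_scope.

Section queue_matrix.
Variables (R : realType) (c : nat) (b h_ : nat -> R) (h beta : R).

Definition Qstar (i j : nat) : R :=
  if i == 0%N then 0
  else if j.+1 == i then (minn i c)%:R * b 0
  else if j == i then b 1 - ((minn i c)%:R - 1) * b 0
  else if (i < j)%N then b (j - i + 1)%N
  else 0.

(* [h] stands for the sum of the [h_ j], [j >= 1]; the value [h_ 0] is never
   used. *)
Definition Qs (i j : nat) : R :=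
  if i == 0%N then (if j == 0%N then - h else h_ j) else 0.

Definition Qd (i j : nat) : R :=
  if i == 0%N then 0
  else if j == 0%N then beta
  else if j == i then - beta
  else 0.

Definition queue_qmatrix (i j : nat) : R := Qstar i j + Qs i j + Qd i j.

End queue_matrix.

Section Markov_chain.
Variable R : realType.

(* The values [p t i j] for [t < 0] are irrelevant. *)
Record is_transition_function (p : R -> nat -> nat -> R) : Prop := {
  transition_ge0 : forall t i j, 0 <= t -> 0 <= p t i j;
  transition_sum1 : forall t i, 0 <= t ->
    (\sum_(0 <= j <oo) (p t i j)%:E = 1)%E;
  transition_0 : forall i j, p 0 i j = (i == j)%:R;
  transition_semigroup : forall s t i j, 0 <= s -> 0 <= t ->
    (\sum_(0 <= k <oo) (p s i k * p t k j)%:E = (p (s + t) i j)%:E)%E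
}.

Definition has_qmatrix (p : R -> nat -> nat -> R) (Q : nat -> nat -> R) : Prop :=
  forall i j, (p t i j - p 0 i j) / t @[t --> 0^'+] --> Q i j.

Variables (d : measure_display) (Omega : measurableType d).

(* The chain is given as a family of laws [P i] (the law of the chain started
   at [i]) on one sample space, with right-continuous paths for the discrete
   topology of the state space; only times [t >= 0] matter. *)
Record is_Markov_chain (p : R -> nat -> nat -> R)
    (P : nat -> probability Omega R) (X : R -> Omega -> nat) : Prop := {
  chain_measurable : forall t, 0 <= t -> measurable_fun setT (X t);
  chain_right_continuous : forall w t, 0 <= t ->
    \forall s \near t^'+, X s w = X t w;
  chain_fdd : forall (n : nat) (t : nat -> R) (x : nat -> nat),
    t 0%N = 0 -> (forall k, t k <= t k.+1) ->
    P (x 0%N) [set w | forall k, (k <= n)%N -> X (t k) w = x k] =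
    (\prod_(k < n) p (t k.+1 - t k) (x k) (x k.+1))%:E
}.

Definition is_Q_process (Q : nat -> nat -> R)
    (P : nat -> probability Omega R) (X : R -> Omega -> nat) : Prop :=
  exists p, [/\ is_transition_function p, has_qmatrix p Q
              & is_Markov_chain p P X].

Local Open Scope ereal_scope.

Definition first_jump_time (X : R -> Omega -> nat) (w : Omega) : \bar R :=
  ereal_inf [set t%:E | t in [set t : R | (0 <= t)%R /\ X t w <> X 0%R w]].

(* Time of the first visit to [i] after the chain has left its initial state;
   [+oo] if there is none. *)
Definition return_time (X : R -> Omega -> nat) (i : nat) (w : Omega) : \bar R :=
  ereal_inf [set t%:E | t in
    [set t : R | (0 <= t)%R /\ first_jump_time X w <= t%:E /\ X t w = i]].

Definition positive_recurrent_state (P : nat -> probability Omega R)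
    (X : R -> Omega -> nat) (i : nat) : Prop :=
  \int[P i]_w return_time X i w < +oo.

Definition positive_recurrent (P : nat -> probability Omega R)
    (X : R -> Omega -> nat) : Prop :=
  forall i, positive_recurrent_state P X i.

End Markov_chain.

(* Main.v *)
Require Import Defs.
From HB Require Import structures.
From mathcomp Require Import all_boot all_order all_algebra.
From mathcomp Require Import all_classical all_reals all_analysis.
From mathcomp Require Import measurable_realfun zify lra ring.

(** Catastrophes bring every state to 0 at rate at least [beta], so 0 is reached
within a short time [T] with a probability that is bounded below uniformly in
the starting state. This is a Doeblin condition, and the chain is irreducible:
resurrection leaves 0, arrivals go arbitrarily far up, departures go down one
step at a time. Hence, for each state [j], all large times [t] have
[p t k j >= e] for all [k], with one [e > 0]. A chain with this property returns
to any state in finite mean time.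

The uniform bound is proved without solving the backward equation
([uniform_hitting0]). Only the derivatives of [p] at 0 are given, and these
limits are not uniform in the starting state. For a fixed [k > 0] and a small
step [s], the semigroup identity gives
[p (s + t) k 0 >= p s k 0 * p t 0 0 + p s k k * p t k 0]. Iterating this [T / s]
times makes the total gain of order [a * T], where [a] is the lower bound for
the rate to 0. The step [s] depends on [k] but the bound does not, because the
exit rates are bounded.

For the return time to [i], the chain is observed at the multiples of a time [L]
at which both [p L k i] and [p L k j] are at least [e], for some [j <> i]. At
each pair of consecutive observations, the chain shows [j] and then [i] with
conditional probability at least [e ^+ 2]. Seeing [j] proves that [i] was left,
so the first such pair bounds the return time, and the probability of not having
seen one after [m] pairs decays geometrically ([no_excursion_decay]). *)

Import Order.TTheory GRing.Theory Num.Theory.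
Import numFieldNormedType.Exports.

Local Open Scope classical_set_scope.
Local Open Scope ring_scope.

(** * Lower bounds for transition functions *)

Lemma near_right0_ex {R : realType} (A : R -> Prop) :
  (\forall t \near 0^'+, A t) ->
  exists2 e : R, 0 < e & forall t : R, 0 < t -> t < e -> A t.
Proof.
case=> e /= e0 He; exists e => // t t0 te.
by apply: He => //=; rewrite sub0r normrN gtr0_norm.
Qed.

Lemma bernoulli_le {R : realType} (x : R) (n : nat) : 0 <= x -> x <= 1 ->
  1 - n%:R * x <= (1 - x) ^+ n.
Proof.
move=> x0 x1; elim: n => [|n IH]; first by rewrite mul0r subr0.
rewrite exprS; apply: (@le_trans _ _ ((1 - x) * (1 - n%:R * x))).
  have : 0 <= n%:R * (x * x) by rewrite mulr_ge0// mulr_ge0.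
  rewrite -natr1; lra.
by rewrite ler_wpM2l// subr_ge0.
Qed.

Section transition_functions.
Context {R : realType} {p : R -> nat -> nat -> R}.
Hypothesis tp : is_transition_function p.

Lemma semigroup_ge (s t : R) (i j n : nat) : 0 <= s -> 0 <= t ->
  \sum_(0 <= k < n) p s i k * p t k j <= p (s + t) i j.
Proof.
move=> s0 t0; rewrite -lee_fin -(transition_semigroup tp)// -sumEFin.
apply: nneseries_lim_ge => k _ _.
by rewrite lee_fin mulr_ge0// (transition_ge0 tp).
Qed.

Lemma semigroup_ge1 (s t : R) (i k j : nat) : 0 <= s -> 0 <= t ->
  p s i k * p t k j <= p (s + t) i j.
Proof.
move=> s0 t0; apply: le_trans (semigroup_ge _ _ _ _ k.+1 s0 t0).
rewrite big_nat_recr//= lerDr sumr_ge0// => l _.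
by rewrite mulr_ge0// (transition_ge0 tp).
Qed.

Lemma semigroup_ge2 (s t : R) (i k j : nat) : 0 <= s -> 0 <= t -> (0 < k)%N ->
  p s i 0 * p t 0 j + p s i k * p t k j <= p (s + t) i j.
Proof.
case: k => // k s0 t0 _; apply: le_trans (semigroup_ge _ _ _ _ k.+2 s0 t0).
rewrite big_nat_recr//= big_nat_recl//= lerD2r lerDl sumr_ge0// => l _.
by rewrite mulr_ge0// (transition_ge0 tp).
Qed.

(** A lower bound that is uniform in the starting state persists: condition on
the state at time [t - s]. *)
Lemma transition_ge_const (e s : R) (j : nat) : 0 <= e -> 0 <= s ->
  (forall k, e <= p s k j) -> forall t k, s <= t -> e <= p t k j.
Proof.
move=> e0 s0 es t k st.
have ts0 : 0 <= t - s by rewrite subr_ge0.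
rewrite -lee_fin -(subrK s t) -(transition_semigroup tp)//.
apply: (@le_trans _ _ (\sum_(0 <= l <oo) (e%:E * (p (t - s) k l)%:E))%E).
  rewrite nneseriesZl ?(transition_sum1 tp) ?mule1// => l _.
  by rewrite lee_fin (transition_ge0 tp).
apply: lee_nneseries => l *; rewrite -EFinM lee_fin.
  by rewrite mulr_ge0// (transition_ge0 tp).
by rewrite mulrC ler_wpM2l// (transition_ge0 tp).
Qed.

(** Decomposition according to the first step [n] at which the chain, observed
at multiples of [s], jumps from [k] to 0: it waits at [k], jumps, and is again
at 0 at the final time with probability at least [a]. *)
Lemma transition_iter (s a : R) (N k : nat) : 0 <= s -> (0 < k)%N ->
  (forall n, (n < N)%N -> a <= p (n%:R * s) 0 0) ->
  p s k 0 * a * \sum_(0 <= n < N) p s k k ^+ n <= p (N%:R * s) k 0.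
Proof.
move=> s0 k0; elim: N => [_|N IH aN].
  by rewrite big_nil mulr0 (transition_ge0 tp)// mul0r.
have {}IH := IH (fun n nN => aN n (leqW nN)).
have -> : N.+1%:R * s = s + N%:R * s by rewrite -natr1; ring.
apply: le_trans (semigroup_ge2 _ _ _ _ _ _ _ k0) => //;
  last by rewrite mulr_ge0.
have -> : \sum_(0 <= n < N.+1) p s k k ^+ n =
    1 + p s k k * \sum_(0 <= n < N) p s k k ^+ n.
  rewrite big_nat_recl//= expr0 mulr_sumr; congr +%R.
  by apply: eq_bigr => n _; rewrite exprS.
rewrite mulrDr mulr1 lerD//.
  by rewrite ler_wpM2l ?(transition_ge0 tp)// aN.
by rewrite mulrCA ler_wpM2l ?(transition_ge0 tp).
Qed.

Context {Q : nat -> nat -> R}.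
Hypothesis pQ : has_qmatrix p Q.

(** The transition function lies above every line of smaller slope than its
derivative at 0, for small times that depend on the two states. *)
Lemma qmatrix_gt_near (i j : nat) (a : R) : a < Q i j ->
  \forall t \near 0^'+, (i == j)%:R + a * t < p t i j.
Proof.
move=> aQ; have := pQ i j => /cvgr_gt /(_ _ aQ) H.
near=> t.
have t0 : 0 < t by near: t; exact: nbhs_right_gt.
have : a < (p t i j - p 0 i j) / t by near: t.
by rewrite ltr_pdivlMr// (transition_0 tp) ltrBrDl.
Unshelve. all: by end_near. Qed.

Definition leads_to (i j : nat) := exists2 t, 0 <= t & 0 < p t i j.

Lemma leads_to_refl i : leads_to i i.
Proof. by exists 0 => //; rewrite (transition_0 tp) eqxx. Qed.

Lemma leads_to_trans j i k : leads_to i j -> leads_to j k -> leads_to i k.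
Proof.
move=> [s s0 ps] [t t0 pt]; exists (s + t); first exact: addr_ge0.
by apply: lt_le_trans (semigroup_ge1 _ _ _ j _ s0 t0); rewrite mulr_gt0.
Qed.

Lemma qmatrix_leads_to i j : i != j -> 0 < Q i j -> leads_to i j.
Proof.
move=> ij /qmatrix_gt_near; rewrite (negbTE ij) => H.
have [t [t0 pt]] : exists t, 0 < t /\ 0 < p t i j.
  have : \forall t \near 0^'+, 0 < t /\ 0 < p t i j.
    near=> t; split; first by near: t; exact: nbhs_right_gt.
    have : 0%:R + 0 * t < p t i j by near: t.
    by rewrite mul0r addr0.
  exact: filter_ex.
by exists t => //; exact: ltW.
Unshelve. all: by end_near. Qed.

(** Doeblin bound. The threshold [T] is chosen so that [p t 0 0 >= 1/2] on
[0, T] and [2 * q * T <= 1/2]; for a step [s] adapted to [k] and dividing [T]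
into [N] steps, the waiting probabilities satisfy
[p s k k ^+ n >= 1 - n * (2 * q * s) >= 1/2], so that [transition_iter] yields
at least [(a / 2 * s) * (1/2) * (N / 2) = a * T / 8]. *)
Lemma uniform_hitting0 (a q : R) : 0 < a -> 0 < q ->
  (forall k, (0 < k)%N -> a <= Q k 0) ->
  (forall k, (0 < k)%N -> - q <= Q k k) ->
  exists T e, [/\ 0 < T, 0 < e & forall k, e <= p T k 0].
Proof.
move=> a0 q0 aQ qQ.
have Q00 : \forall t \near 0^'+, 2^-1 <= p t 0 0.
  (* Any slope below [Q 0 0] does; it only has to make [p t 0 0] close to 1. *)
  pose A := Q 0 0 - 1.
  have AQ : A < Q 0 0 by rewrite /A; lra.
  have H := qmatrix_gt_near _ _ _ AQ.
  have c0 : 0 < 2^-1 / (`|A| + 1) by rewrite divr_gt0// ltr_pwDr.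
  near=> t.
  have t0 : 0 < t by near: t; exact: nbhs_right_gt.
  have tc : t < 2^-1 / (`|A| + 1) by near: t; exact: nbhs_right_lt.
  have : (0 == 0 :> nat)%:R + A * t < p t 0 0 by near: t.
  move=> /ltW; apply: le_trans; rewrite eqxx /=.
  move: tc; rewrite ltr_pdivlMr ?ltr_pwDr// => tc.
  have : - (`|A| * t) <= A * t.
    by rewrite -mulNr ler_wpM2r ?(ltW t0)// lerNl -normrN ler_norm.
  lra.
have [T0 T00 HT0] := near_right0_ex _ Q00.
have {}HT0 (t : R) : 0 <= t -> t < T0 -> 2^-1 <= p t 0 0.
  rewrite le_eqVlt => /predU1P[<- _|]; last exact: HT0.
  rewrite (transition_0 tp) eqxx /=; lra.
pose T := Num.min (T0 / 2) (4 * q)^-1.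
have T_gt0 : 0 < T by rewrite lt_min divr_gt0//= invr_gt0 mulr_gt0.
have TT0 : T < T0.
  by rewrite gt_min; apply/orP; left; lra.
have Tq : 2 * q * T <= 2^-1.
  have : T <= (4 * q)^-1 by rewrite ge_min lexx orbT.
  rewrite -(@ler_pM2l _ (4 * q)) ?mulr_gt0// divff; last first.
    by rewrite mulf_neq0// gt_eqF.
  lra.
exists T, (Num.min 2^-1 (a * T / 8)); split => //.
  by rewrite lt_min !mulr_gt0// ?andbT invr_gt0.
case=> [|k]; first by rewrite ge_min HT0// ltW.
rewrite ge_min; apply/orP; right.
set K := k.+1; have K0 : (0 < K)%N by [].
have HQ0 : a / 2 < Q K 0 by apply: lt_le_trans (aQ _ K0); lra.
have HQK : - (2 * q) < Q K K by apply: lt_le_trans (qQ _ K0); lra.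
have H : \forall t \near 0^'+, [/\ 0 < t, a / 2 * t < p t K 0 &
     1 - 2 * q * t < p t K K].
  have H1 := qmatrix_gt_near _ _ _ HQ0.
  have H2 := qmatrix_gt_near _ _ _ HQK.
  near=> t; split.
  - by near: t; exact: nbhs_right_gt.
  - have : (K == 0)%:R + a / 2 * t < p t K 0 by near: t.
    by rewrite eqn0Ngt K0 add0r.
  - have : (K == K)%:R + - (2 * q) * t < p t K K by near: t.
    by rewrite eqxx mulNr.
have [d d0 Hd] : exists2 d : R, 0 < d & forall t : R, 0 < t -> t < d ->
    [/\ 0 < t, a / 2 * t < p t K 0 & 1 - 2 * q * t < p t K K].
  exact: near_right0_ex.
(* [T] is split into [N] equal steps shorter than the radius [d] at which the
   expansions at the state [K] hold. *)
pose N := (Num.truncn (T / d)).+1.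
have N0 : 0 < N%:R :> R by rewrite ltr0n.
have TN : T / N%:R < d.
  have : T / d < N%:R by rewrite /N truncnS_gt.
  by rewrite !ltr_pdivrMr// mulrC.
pose s := T / N%:R.
have s0 : 0 < s by rewrite divr_gt0.
have Ns : N%:R * s = T by rewrite /s mulrC divfK// gt_eqF.
have [_ Hs0 HsK] := Hd _ s0 TN.
have half n : (n < N)%N -> 2^-1 <= p (n%:R * s) 0 0.
  move=> nN; apply: HT0; first by rewrite mulr_ge0// ltW.
  by apply: lt_trans TT0; rewrite -Ns ltr_pM2r// ltr_nat.
rewrite -Ns; apply: le_trans (transition_iter _ _ _ _ (ltW s0) K0 half).
have HS : N%:R / 2 <= \sum_(0 <= n < N) p s K K ^+ n.
  have -> : N%:R / 2 = \sum_(0 <= n < N) (2^-1 : R).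
    by rewrite sumr_const_nat subn0 -[RHS]mulr_natl.
  rewrite big_nat [leRHS]big_nat; apply: ler_sum => n /andP[_ nN].
  have nT : n%:R * s <= T by rewrite -Ns ler_pM2r// ler_nat ltnW.
  have qs : 2 * q * s <= 1.
    have : s <= T.
      by rewrite -Ns; apply: ler_peMl; rewrite ?ler1n ?ltW.
    move=> sT; have : 2 * q * s <= 2 * q * T by rewrite ler_pM2l// mulr_gt0.
    lra.
  have qs0 : 0 <= 2 * q * s by rewrite !mulr_ge0// ltW.
  apply: (@le_trans _ _ ((1 - 2 * q * s) ^+ n)); last first.
    by rewrite lerXn2r// ?nnegrE ?subr_ge0// ?(transition_ge0 tp)// ltW.
  apply: le_trans (bernoulli_le _ _ qs0 qs).
  have : 2 * q * (n%:R * s) <= 2 * q * T by rewrite ler_pM2l// mulr_gt0.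
  lra.
apply: (@le_trans _ _ (a / 2 * s * 2^-1 * (N%:R / 2))).
  lra.
apply: ler_pM => //.
- by rewrite !mulr_ge0// ltW.
- by rewrite ler_wpM2r// ltW.
Unshelve. all: by end_near. Qed.

Lemma uniform_hitting (j : nat) :
  (exists T e, [/\ 0 < T, 0 < e & forall k, e <= p T k 0]) -> leads_to 0 j ->
  exists T e, [/\ 0 < T, 0 < e & forall t k, T <= t -> e <= p t k j].
Proof.
move=> [T [e [T0 e0 He]]] [s s0 ps].
have Ts : 0 < T + s by rewrite ltr_pwDl.
exists (T + s), (e * p s 0 j); split => //; first by rewrite mulr_gt0.
move=> t k; apply: transition_ge_const; rewrite ?mulr_ge0// ?ltW// => l.
apply: le_trans (semigroup_ge1 _ _ _ 0 _ (ltW T0) s0).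
by rewrite ler_wpM2r// ltW.
Qed.

End transition_functions.

(** * Integration and fibres *)

(** The integral of a nonnegative function is a supremum over the simple
functions below it, hence monotone even when nothing is known about
measurability. This spares the proof that return times are measurable. *)
Lemma ge0_le_lower_integral {R : realType} {d : measure_display}
    {T : measurableType d} (mu : {measure set T -> \bar R})
    (f g : T -> \bar R) :
  (forall x, 0 <= f x)%E -> (forall x, f x <= g x)%E ->
  (\int[mu]_x f x <= \int[mu]_x g x)%E.
Proof.
move=> f0 fg; have g0 x : (0 <= g x)%E by exact: le_trans (fg x).
rewrite !ge0_integralE//; apply: ereal_sup_le => _ [k /= kf <-].
exists k => //= x; apply: le_trans (kf x) _.
by rewrite !patch_setT.
Qed.

(** A geometric decay [mu (B m.+1) <= (1 - e) * mu (B m)], written so that the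
sum telescopes: [e] times the sum over [m < n], plus [mu (B n)], is at most
[mu (B 0) <= 1]. *)
Lemma decay_series_le {R : realType} {d : measure_display}
    {Omega : measurableType d} (mu : probability Omega R)
    (B : nat -> set Omega) (e : R) :
  0 < e -> measurable (B 0) ->
  (forall m, e%:E * mu (B m) + mu (B m.+1) <= mu (B m))%E ->
  (\sum_(0 <= m <oo) mu (B m) <= (e^-1)%:E)%E.
Proof.
move=> e0 mB0 Bdec.
apply: lime_le; first exact: is_cvg_nneseries.
apply: nearW => n /=.
rewrite -(@lee_pmul2l _ e%:E)// -EFinM divff ?gt_eqF//.
apply: (@le_trans _ _ (e%:E * (\sum_(0 <= m < n) mu (B m)) + mu (B n))%E).
  by rewrite leeDl.
apply: le_trans (probability_le1 _ mB0).
elim: n => [|n IH]; first by rewrite big_nil mule0 add0e.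
rewrite big_nat_recr//= ge0_muleDr ?sume_ge0// -addeA.
by apply: le_trans IH; rewrite leeD2l.
Qed.

Lemma trivIset_fiber {T I : Type} (f : T -> I) (B : set T) :
  trivIset setT (fun m => B `&` [set w | f w = m]).
Proof. by move=> m m' _ _ [w [[_ <-] [_ <-]]]. Qed.

Lemma bigcup_fiber {T I : Type} (f : T -> I) (B : set T) :
  \bigcup_m (B `&` [set w | f w = m]) = B.
Proof. by apply/seteqP; split => [w [m _ []]//|w Bw]; exists (f w). Qed.

(** * The chain observed at multiples of a fixed time *)

Section skeleton.
Context {R : realType} {p : R -> nat -> nat -> R}.
Context {d : measure_display} {Omega : measurableType d}.
Context {P : nat -> probability Omega R} {X : R -> Omega -> nat}.
Hypothesis tp : is_transition_function p.
Hypothesis PX : is_Markov_chain p P X.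
Context {L : R}.
Hypothesis L0 : 0 <= L.

Definition skeleton (n : nat) (w : Omega) : nat := X (n%:R * L) w.

(** Measurability with respect to the first [n.+1] observations, stated on
sample points: as the state space is countable, it implies measurability. *)
Definition known_at (n : nat) (B : set Omega) :=
  forall w w', (forall k, (k <= n)%N -> skeleton k w = skeleton k w') ->
  B w -> B w'.

Lemma measurable_skeleton n y : measurable [set w | skeleton n w = y].
Proof.
have nL : 0 <= n%:R * L by rewrite mulr_ge0.
have /(_ measurableT [set y] I) := chain_measurable PX nL.
by rewrite setTI; congr measurable.
Qed.

Definition cylinder n (x : nat -> nat) :=
  [set w | forall k, (k <= n)%N -> skeleton k w = x k].

Lemma measurable_cylinder n x : measurable (cylinder n x).
Proof.
rewrite (_ : cylinder n x =
  \bigcap_(k in [set k | (k <= n)%N]) [set w | skeleton k w = x k]).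
  by apply: bigcap_measurableType => k _; exact: measurable_skeleton.
by apply/seteqP; split => w /=; exact.
Qed.

Lemma cylinder_prob n x :
  P (x 0%N) (cylinder n x) = (\prod_(k < n) p L (x k) (x k.+1))%:E.
Proof.
rewrite (_ : cylinder n x =
  [set w | forall k, (k <= n)%N -> X (k%:R * L) w = x k])//.
rewrite (chain_fdd PX).
- congr EFin; apply: eq_bigr => k _.
  by rewrite -natr1 mulrDl mul1r addrAC subrr add0r.
- by rewrite mul0r.
- by move=> k; rewrite ler_wpM2r// ler_nat.
Qed.

Lemma skeleton_start i : P i [set w | skeleton 0 w = i] = 1%E.
Proof.
have := cylinder_prob 0 (fun=> i); rewrite big_ord0 => <-; congr (P i _).
apply/seteqP; split => w /=; last exact.
by move=> wi k; rewrite leqn0 => /eqP ->.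
Qed.

(** The Markov property of the observed chain, on a single cylinder. *)
Lemma cylinder_step n x i y (dl : R) : (forall k, dl <= p L k y) ->
  x 0 = i ->
  (dl%:E * P i (cylinder n x) <=
   P i (cylinder n x `&` [set w | skeleton n.+1 w = y]))%E.
Proof.
move=> dlp <-; pose x' k := if (k <= n)%N then x k else y.
have -> : cylinder n x `&` [set w | skeleton n.+1 w = y] = cylinder n.+1 x'.
  apply/seteqP; split => w /=.
    move=> [xw yw] k; rewrite /x'; case: (leqP k n) => [kn _|nk kn1].
      exact: xw.
    by rewrite (_ : k = n.+1)//; apply/eqP; rewrite eqn_leq kn1.
  move=> H; split => [k kn|]; first by rewrite H/x' ?kn// ltnW.
  by rewrite H /x' ?ltnn.
rewrite -[in leRHS](_ : x' 0 = x 0)//.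
rewrite !cylinder_prob -EFinM lee_fin big_ord_recr /= mulrC.
rewrite [x' n.+1](_ : _ = y); last by rewrite /x' ltnn.
rewrite [leRHS](_ : _ = (\prod_(i < n) p L (x i) (x i.+1)) * p L (x' n) y).
  by rewrite ler_wpM2l// prodr_ge0// => k _; exact: transition_ge0.
by congr (_ * _); apply: eq_bigr => k _; rewrite /x' ltn_ord (ltnW (ltn_ord _)).
Qed.

Definition history n w := [seq skeleton k w | k <- iota 0 n.+1].

Lemma history_eq n w w' : history n w = history n w' <->
  forall k, (k <= n)%N -> skeleton k w = skeleton k w'.
Proof.
split => [/eq_in_map H k kn|H]; last first.
  by apply/eq_in_map => k; rewrite mem_iota ltnS => /H.
by apply: H; rewrite mem_iota.
Qed.

(** The countably many possible histories, numbered by [pickle], cut an event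
known at time [n] into cylinders. *)
Lemma known_at_split n B : known_at n B -> forall m,
  (B `&` [set w | pickle (history n w) = m] = set0) \/
  exists2 w0, B w0 & B `&` [set w | pickle (history n w) = m] =
    cylinder n (fun k => skeleton k w0).
Proof.
move=> nB m; set F := _ `&` _.
have [->|/set0P[w0 [Bw0 w0m]]] := eqVneq F set0; first by left.
right; exists w0 => //; apply/seteqP; split => w.
  move=> [Bw wm]; apply/history_eq; apply: (pcan_inj pickleK).
  by rewrite wm.
move=> /= /history_eq ww0; split; last by rewrite /= ww0.
by apply: nB Bw0; apply/history_eq.
Qed.

Lemma measurable_fiber n B m : known_at n B ->
  measurable (B `&` [set w | pickle (history n w) = m]).
Proof.
move=> /known_at_split/(_ m) [->//|[w0 _ ->]]; exact: measurable_cylinder.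
Qed.

Lemma measurable_known_at n B : known_at n B -> measurable B.
Proof.
move=> nB; rewrite -(bigcup_fiber (fun w => pickle (history n w)) B).
by apply: bigcupT_measurable => m; exact: measurable_fiber.
Qed.

(** The Markov inequality for events of the past, by summing [cylinder_step]
over the histories. The starting state is fixed because the finite-dimensional
laws of [P i] are given only for paths from [i]. *)
Lemma known_at_step n B i y (dl : R) : 0 <= dl -> (forall k, dl <= p L k y) ->
  known_at n B -> (forall w, B w -> skeleton 0 w = i) ->
  (dl%:E * P i B <= P i (B `&` [set w | skeleton n.+1 w = y]))%E.
Proof.
move=> dl0 dlp nB Bi.
pose F m := B `&` [set w | pickle (history n w) = m].
have mF m : measurable (F m) by exact: measurable_fiber.
pose S := [set w | skeleton n.+1 w = y].
have FB : \bigcup_m F m = B by exact: bigcup_fiber.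
have tF : trivIset setT F by exact: trivIset_fiber.
have -> : P i B = (\sum_(0 <= m <oo) P i (F m))%E.
  by rewrite -{1}FB measure_semi_bigcup// FB; exact: measurable_known_at nB.
have -> : P i (B `&` S) = (\sum_(0 <= m <oo) P i (F m `&` S))%E.
  rewrite -{1}FB setI_bigcupl measure_semi_bigcup//.
  - by move=> m; apply: measurableI => //; exact: measurable_skeleton.
  - exact: trivIset_setIr.
  - apply: bigcupT_measurable => m; apply: measurableI => //.
    exact: measurable_skeleton.
rewrite -nneseriesZl//; apply: lee_nneseries => m *; first by rewrite mule_ge0.
have [F0|[w0 Bw0 F0]] := known_at_split _ _ nB m; rewrite /F F0.
  by rewrite set0I measure0 mule0.
by apply: cylinder_step => //; exact: Bi.
Qed.

End skeleton.

(** * Bounding the return time *)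

(** Being away from the initial state at time [s] shows that the first jump has
occurred by then. *)
Lemma return_time_le {R : realType} {d : measure_display}
    {Omega : measurableType d} (X : R -> Omega -> nat) (i : nat)
    (w : Omega) (s t : R) :
  0 <= s -> s <= t -> X s w <> X 0 w -> X t w = i ->
  (return_time X i w <= t%:E)%E.
Proof.
move=> s0 st Xs Xt; apply: ereal_inf_lbound; exists t => //=.
split; first exact: le_trans st.
split=> //; apply: (@le_trans _ _ s%:E); last by rewrite lee_fin.
by apply: ereal_inf_lbound; exists s.
Qed.

Lemma return_time_ge0 {R : realType} {d : measure_display}
    {Omega : measurableType d} (X : R -> Omega -> nat) (i : nat)
    (w : Omega) : (0 <= return_time X i w)%E.
Proof. by apply: le_ereal_inf_tmp => _ [t [t0 _] <-]; rewrite lee_fin. Qed.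

Section return_time_bound.
Context {R : realType} {p : R -> nat -> nat -> R}.
Context {d : measure_display} {Omega : measurableType d}.
Context {P : nat -> probability Omega R} {X : R -> Omega -> nat}.
Hypothesis tp : is_transition_function p.
Hypothesis PX : is_Markov_chain p P X.
Context {L : R}.
Hypothesis L_gt0 : 0 < L.
Let L0 : 0 <= L := ltW L_gt0.
Local Notation Y := (skeleton (X := X) (L := L)).

Context {i j : nat}.
Hypothesis ij : i <> j.

(** The start at [i] is included so that the bound of the return time holds at
every sample point, also outside the almost sure event [Y 0 w = i]. *)
Definition excursion m : set Omega :=
  [set w | [/\ Y 0 w = i, Y m.*2.+1 w = j & Y m.*2.+2 w = i]].

Definition no_excursion m : set Omega :=
  [set w | forall l, (l < m)%N -> ~ excursion l w].

Lemma known_at_no_excursion m :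
  known_at (X := X) (L := L) m.*2 (no_excursion m).
Proof.
move=> w w' ww' Bw l lm [Y0 Y1 Y2]; apply: (Bw l lm).
have l2 : (l.*2.+2 <= m.*2)%N by rewrite -doubleS leq_double.
by split; rewrite ww'// ltnW.
Qed.

Lemma measurable_no_excursion m : measurable (no_excursion m).
Proof. exact: (measurable_known_at PX L0 _ _ (known_at_no_excursion m)). Qed.

Lemma return_time_excursion m (w : Omega) : excursion m w ->
  (return_time X i w <= (m.+1%:R * (2 * L))%:E)%E.
Proof.
move=> [Y0 Y1 Y2].
have <- : m.*2.+2%:R * L = m.+1%:R * (2 * L).
  by rewrite -doubleS -mul2n natrM; ring.
apply: (return_time_le _ _ _ (m.*2.+1%:R * L)).
- by rewrite mulr_ge0.
- by rewrite ler_pM2r// ler_nat.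
- have : Y 0 w <> Y m.*2.+1 w by rewrite Y0 Y1.
  by rewrite /skeleton mul0r => /nesym.
- exact: Y2.
Qed.

(** The series counts the blocks up to and including the first one that is an
excursion, each of length [2 * L]; it diverges if there is none. *)
Lemma return_time_le_series (w : Omega) :
  (return_time X i w <=
   \sum_(0 <= m <oo) (2 * L)%:E * (\1_(no_excursion m) w)%:E)%E.
Proof.
have partial n : no_excursion n w -> ((n.+1%:R * (2 * L))%:E <=
    \sum_(0 <= m <oo) (2 * L)%:E * (\1_(no_excursion m) w)%:E)%E.
  move=> Bn; apply: le_trans (nneseries_lim_ge n.+1 _) => [|m _ _]; last first.
    by rewrite -EFinM lee_fin mulr_ge0// mulr_ge0.
  rewrite (eq_big_nat _ _ (F2 := fun=> (2 * L)%:E)) => [|m /andP[_ mn]].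
    by rewrite sumEFin sumr_const_nat subn0 mulr_natl.
  rewrite indicE mem_set ?mule1// => l lm; apply: Bn.
  exact: leq_trans lm _.
have [[m Em]|noE] := pselect (exists m, excursion m w); last first.
  rewrite (_ : (\sum_(0 <= m <oo) _ = +oo)%E) ?leey//.
  apply/eqyP => A A0.
  have L2 : 0 < 2 * L by rewrite mulr_gt0.
  apply: le_trans (partial (Num.truncn (A / (2 * L))) _); last first.
    by move=> l _ El; apply: noE; exists l.
  by rewrite lee_fin -ler_pdivrMr// ltW// truncnS_gt.
have exE : exists m, `[< excursion m w >] by exists m; exact: asboolT.
have [{Em}m /asboolP Em minm] := ex_minnP exE.
apply: le_trans (return_time_excursion m w Em) (partial m _).
by move=> l lm El; have := minm l (asboolT El); rewrite leqNgt lm.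
Qed.

Context {e : R}.
Hypothesis e_gt0 : 0 < e.
Hypothesis pi_ge : forall k, e <= p L k i.
Hypothesis pj_ge : forall k, e <= p L k j.

(** Whatever the past, the next two observations are [j] and [i] with
conditional probability at least [e * e]. *)
Lemma no_excursion_decay m :
  ((e ^+ 2)%:E * P i (no_excursion m) + P i (no_excursion m.+1) <=
   P i (no_excursion m))%E.
Proof.
pose S := [set w | Y 0 w = i].
have mS : measurable S := measurable_skeleton PX L0 0 i.
have mB n := measurable_no_excursion n.
(* The Markov inequality needs events inside [S], which costs a null set. *)
pose C := no_excursion m `&` S.
have PC : P i (no_excursion m) = P i C.
  rewrite (measureDI (P i) (mB m) mS) [X in (X + _)%E](_ : _ = 0)%E ?add0e//.
  apply/eqP; rewrite eq_le measure_ge0 andbT.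
  apply: (@le_trans _ _ (P i (~` S))).
    apply: le_measure; rewrite ?inE; last by move=> w [].
      exact: measurableD.
    exact: measurableC.
  by rewrite probability_setC// (skeleton_start PX L0) subee.
have kC : known_at (X := X) (L := L) m.*2 C.
  move=> w w' ww' [Bw Sw]; split; first exact: known_at_no_excursion ww' Bw.
  by rewrite /S /= -ww'.
pose Cj := C `&` [set w | Y m.*2.+1 w = j].
have kCj : known_at (X := X) (L := L) m.*2.+1 Cj.
  move=> w w' ww' [Cw jw]; split; last by rewrite /= -ww'.
  by apply: kC Cw => k km; apply: ww'; exact: leqW.
have e0 := ltW e_gt0.
have H1 : (e%:E * P i C <= P i Cj)%E.
  by apply: (known_at_step tp PX L0 _ _ _ _ _ e0 pj_ge kC) => w [].
have H2 : (e%:E * P i Cj <= P i (Cj `&` [set w | Y m.*2.+2 w = i]))%E.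
  by apply: (known_at_step tp PX L0 _ _ _ _ _ e0 pi_ge kCj) => w [[]].
rewrite {1}PC expr2 EFinM -muleA.
apply: (@le_trans _ _ (P i (Cj `&` [set w | Y m.*2.+2 w = i]) +
                       P i (no_excursion m.+1))%E).
  rewrite leeD2r//; apply: le_trans H2; exact: lee_wpmul2l.
have mE : measurable (Cj `&` [set w | Y m.*2.+2 w = i]).
  apply: measurableI; first exact: (measurable_known_at PX L0 _ _ kCj).
  exact: (measurable_skeleton PX L0).
rewrite -measureU//.
  apply: le_measure; rewrite ?inE//; first exact: measurableU.
  move=> w [[[[Bw _] _] _]//|Bw] l lm; apply: Bw; exact: ltnW.
apply/seteqP; split => w //= [[[[_ S0] Y1] Y2]] Bw.
exact: (Bw m).
Qed.

Lemma positive_recurrent_state_excursion : positive_recurrent_state P X i.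
Proof.
have L2 : 0 <= 2 * L by rewrite mulr_ge0.
apply: (@le_lt_trans _ _ ((2 * L)%:E * ((e ^+ 2)^-1)%:E)%E); last first.
  by rewrite -EFinM ltry.
apply: le_trans (ge0_le_lower_integral _ _ _ _ return_time_le_series) _.
  exact: return_time_ge0.
rewrite integral_nneseries//.
- under eq_eseriesr => m _.
    rewrite ge0_integralZl_EFin//; last first.
      apply/measurable_EFinP; apply: measurable_indic.
      exact: measurable_no_excursion.
    rewrite integral_indic// ?setIT; last exact: measurable_no_excursion.
    over.
  rewrite nneseriesZl//; apply: lee_wpmul2l => //.
  apply: decay_series_le; [exact: exprn_gt0|exact: measurable_no_excursion|].
  exact: no_excursion_decay.
- move=> m; apply: measurable_funeM; apply/measurable_EFinP.
  apply: measurable_indic.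
  exact: measurable_no_excursion.
- by move=> m w _; rewrite -EFinM lee_fin mulr_ge0.
Qed.

End return_time_bound.

(** * Positive recurrence from a uniform rate to 0 *)

Section catastrophes.
Context {R : realType} {p : R -> nat -> nat -> R} {Q : nat -> nat -> R}.
Context {d : measure_display} {Omega : measurableType d}.
Context {P : nat -> probability Omega R} {X : R -> Omega -> nat}.

(** Times [s] and [t] after which [i] and [i.+1] have uniform lower bounds give
a common observation step; [i.+1] serves as the witness that [i] was left. *)
Lemma positive_recurrent_catastrophes (a q : R) :
  is_transition_function p -> has_qmatrix p Q -> is_Markov_chain p P X ->
  0 < a -> 0 < q ->
  (forall k, (0 < k)%N -> a <= Q k 0) ->
  (forall k, (0 < k)%N -> - q <= Q k k) ->
  (forall i, leads_to (p := p) 0 i) -> positive_recurrent P X.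
Proof.
move=> tp pQ PX a0 q0 aQ qQ reach i.
have H0 := uniform_hitting0 tp pQ a q a0 q0 aQ qQ.
have [s [e [s0 e0 He]]] := uniform_hitting tp i H0 (reach i).
have [t [f [t0 f0 Hf]]] := uniform_hitting tp i.+1 H0 (reach i.+1).
have L0 : 0 < Num.max s t by rewrite lt_max s0.
have ef0 : 0 < Num.min e f by rewrite lt_min e0.
apply: (positive_recurrent_state_excursion tp PX L0 _ ef0 (j := i.+1)).
- exact: n_Sn.
- by move=> k; rewrite ge_min He ?le_max ?lexx.
- by move=> k; rewrite ge_min Hf ?le_max ?lexx ?orbT.
Qed.

End catastrophes.

(** * The rates of the queue *)

Section queue.
Context {R : realType} {c : nat} {b h_ : nat -> R} {h beta : R}.
Local Notation Q := (queue_qmatrix c b h_ h beta).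

Lemma queue_resurrection j : (0 < j)%N -> Q 0 j = h_ j.
Proof.
by case: j => // j _; rewrite /queue_qmatrix /Qstar /Qs /Qd /= add0r addr0.
Qed.

Lemma queue_arrival k m : (0 < k)%N -> Q k (k + m.+1) = b m.+2.
Proof.
case: k => // k _; rewrite /queue_qmatrix /Qstar /Qs /Qd /=.
have -> : ((k.+1 + m.+1).+1 == k.+1) = false by apply/eqP; lia.
have -> : (k.+1 + m.+1 == k.+1)%N = false by apply/eqP; lia.
have -> : (k.+1 < k.+1 + m.+1)%N by lia.
by rewrite !addr0; congr b; lia.
Qed.

Hypothesis b0_ge0 : 0 <= b 0.
Hypothesis beta_ge0 : 0 <= beta.

Lemma queue_catastrophe k : (0 < k)%N -> beta <= Q k 0.
Proof.
case: k => // k _; rewrite /queue_qmatrix /Qstar /Qs /Qd /= addr0.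
by case: ifP => _; rewrite ?add0r// lerDr mulr_ge0.
Qed.

Lemma queue_diag k : (0 < k)%N -> - (- b 1 + c%:R * b 0 + beta) <= Q k k.
Proof.
case: k => // k _; rewrite /queue_qmatrix /Qstar /Qs /Qd /= addr0.
have -> : (k.+2 == k.+1) = false by apply/eqP; lia.
rewrite !eqxx !opprD opprK lerD2r lerD2l lerN2 ler_wpM2r//.
by rewrite (@le_trans _ _ (minn k.+1 c)%:R)// ?gerBl// ler_nat geq_minr.
Qed.

Lemma queue_departure k : (0 < c)%N -> 0 < b 0 -> 0 < Q k.+1 k.
Proof.
move=> c0 b0; rewrite /queue_qmatrix /Qstar /Qs /Qd /= eqxx addr0.
have mb : 0 < (minn k.+1 c)%:R * b 0 by rewrite mulr_gt0// ltr0n leq_min.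
case: ifP => _; first by rewrite ltr_wpDr.
have -> : (k == k.+1) = false by apply/eqP; lia.
by rewrite addr0.
Qed.
End queue.

Lemma nneseries_gt0_ex {R : realType} (u : nat -> R) (m : nat) :
  (forall j, (m <= j)%N -> 0 <= u j) -> (0 < \sum_(m <= j <oo) (u j)%:E)%E ->
  exists2 j, (m <= j)%N & 0 < u j.
Proof.
move=> u0; apply: contraPP => nou; rewrite eseries0 ?ltxx// => j mj _.
congr EFin; apply/eqP; rewrite eq_le u0// andbT leNgt.
by apply/negP => uj; apply: nou; exists j.
Qed.

(** Resurrection leads from 0 to some [j >= 1], repeated arrivals of [m.+1]
customers lead beyond any level, and departures lead down from there to [i]. *)
Lemma queue_reachable_from0 (R : realType) (c : nat) (b h_ : nat -> R) (h beta : R)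
  (p : R -> nat -> nat -> R) (i : nat) :
  is_transition_function p -> has_qmatrix p (queue_qmatrix c b h_ h beta) ->
  (0 < c)%N -> 0 <= beta -> 0 < b 0 ->
  (exists2 j, (2 <= j)%N & 0 < b j) -> (exists2 j, (1 <= j)%N & 0 < h_ j) ->
  leads_to (p := p) 0 i.
Proof.
move=> tp pQ c0 beta0 b0 [[|[|m]]// _ bm] [j j0 hj].
have down k l : (l <= k)%N -> leads_to (p := p) k l.
  move=> lk; rewrite -(subnK lk); elim: (k - l)%N => [|n IH].
    exact: leads_to_refl.
  apply: leads_to_trans IH => //.
  apply: (qmatrix_leads_to tp pQ); first by rewrite addSn neq_ltn ltnSn orbT.
  by apply: queue_departure => //; exact: ltW.
have up n : exists2 k, (n < k)%N & leads_to (p := p) 0 k.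
  elim: n => [|n [k nk ok]].
    exists j => //; apply: (qmatrix_leads_to tp pQ).
      by rewrite neq_ltn j0.
    by rewrite queue_resurrection.
  exists (k + m.+1)%N; first by lia.
  apply: leads_to_trans ok _ => //; apply: (qmatrix_leads_to tp pQ).
    by apply/eqP; lia.
  by rewrite queue_arrival// (leq_trans _ nk).
have [k ik ok] := up i.
exact: leads_to_trans ok (down _ _ (ltnW ik)).
Qed.

Theorem theorem4p3 (R : realType) (c : nat) (b h_ : nat -> R) (h beta : R)
  (c_ge1 : (1 <= c)%N)
  (b_ge0 : forall j : nat, j <> 1%N -> 0 <= b j)
  (b1_lt0 : 0 < - b 1%N)
  (b_sum : (\sum_(0 <= j <oo | j != 1%N) (b j)%:E = (- b 1%N)%:E)%E)
  (b0_gt0 : 0 < b 0%N)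
  (b_up : (0 < \sum_(2 <= j <oo) (b j)%:E)%E)
  (h_ge0 : forall j : nat, (1 <= j)%N -> 0 <= h_ j)
  (h_sum : (\sum_(1 <= j <oo) (h_ j)%:E = h%:E)%E)
  (beta_ge0 : 0 <= beta)
  (d : measure_display) (Omega : measurableType d)
  (P : nat -> probability Omega R) (X : R -> Omega -> nat)
  (QX : is_Q_process (queue_qmatrix c b h_ h beta) P X) :
  0 < h -> 0 < beta -> positive_recurrent P X.
Proof.
move=> h0 beta0; have [p [tp pQ PX]] := QX.
pose q := - b 1 + c%:R * b 0 + beta.
apply: (positive_recurrent_catastrophes beta q tp pQ PX) => //.
- by rewrite ltr_wpDl ?addr_ge0 ?mulr_ge0 ?(ltW b1_lt0) ?(ltW b0_gt0).
- by move=> k; apply: queue_catastrophe => //; exact: ltW.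
- by move=> k; apply: queue_diag => //; exact: ltW.
- move=> i; apply: (queue_reachable_from0 _ _ _ _ _ _ _ _ tp pQ) => //.
  + apply: nneseries_gt0_ex => // j j2; apply: b_ge0; lia.
  + by apply: nneseries_gt0_ex; rewrite ?h_sum ?lte_fin.
Qed.
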